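(* There exists a weakly dense $G_\delta$ set $E\subset\mathbb{R}$ which is not $\operatorname{Lip}1$.
   Context: For a continuous $f:\mathbb{R}\to\mathbb{R}$, $x\in\mathbb{R}$ and $r>0$ put $M_f(x,r)=\frac{1}{r}\sup\{|f(x)-f(y)|:|x-y|\le r\}$ and $\operatorname{Lip} f(x)=\limsup_{r\to0^+}M_f(x,r)$. A set $E\subseteq\mathbb{R}$ is $\operatorname{Lip}1$ if there is a continuous $f:\mathbb{R}\to\mathbb{R}$ with $\operatorname{Lip} f=\mathbf{1}_E$ (the characteristic function of $E$). $|A|$ denotes the Lebesgue measure of $A$. For a sequence of non-degenerate closed intervals $\{I_n\}$, write $I_n\to x$ if $x\in I_n$ for all $n\in\mathbb{N}$ and $|I_n|\to0$. A measurable set $E$ is weakly dense at $x$ if there exists $I_n\to x$ with $\frac{|E\cap I_n|}{|I_n|}\to1$; $E$ is weakly dense if it is weakly dense at every $x\in E$. *)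

(* Defs.v *)
From mathcomp Require Import all_boot all_order all_algebra.
From mathcomp Require Import all_classical all_reals all_analysis.

Set Implicit Arguments.
Unset Strict Implicit.
Unset Printing Implicit Defensive.

Import Order.TTheory GRing.Theory Num.Theory.
Import numFieldNormedType.Exports.

Local Open Scope classical_set_scope.
Local Open Scope ring_scope.

(* M_f(x, r); the supremum is taken in \bar R and is finite when f is
   continuous. *)
Definition max_slope (R : realType) (f : R -> R) (x r : R) : \bar R :=
  ((r^-1)%:E *
     ereal_sup [set `|f x - f y|%:E | y in [set y | `|x - y| <= r]%R])%E.

Definition Lip (R : realType) (f : R -> R) (x : R) : \bar R :=
  limf_esup (max_slope f x) 0^'+.

Definition Lip1 (R : realType) (E : set R) : Prop :=
  exists f : R -> R, continuous f /\ forall x, Lip f x = (\1_E x)%:E.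

(* Caratheodory measurability for the Lebesgue outer measure; these sets form
   the domain of completed_lebesgue_measure. *)
Definition Lebesgue_measurable (R : realType) (E : set R) : Prop :=
  (wlength (@idfun R))^*%mu.-cara.-measurable E.

(* Applied below only to sets of finite measure. *)
Definition len (R : realType) (A : set R) : R :=
  fine (completed_lebesgue_measure A).

Definition weakly_dense_at (R : realType) (E : set R) (x : R) : Prop :=
  exists a b : nat -> R,
    let I n := `[a n, b n]%classic in
    [/\ forall n, a n < b n,
        forall n, I n x,
        len (I n) @[n --> \oo] --> (0 : R)
      & len (E `&` I n) / len (I n) @[n --> \oo] --> (1 : R)].

Definition weakly_dense (R : realType) (E : set R) : Prop :=
  Lebesgue_measurable E /\ forall x, E x -> weakly_dense_at E x.

(* Main.v *)
(* A cell (m, a, g) has core ]a - g, a + g[ and, to the right of its centre a, a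
   solid interval ]a + 2^-m g, a + g[ contained in E.  To the left of a there is
   one subcell of the same level m in each dyadic shell [a - d, a - d/2],
   d = 2^-k g; very close to a on the right there is one subcell of level m + 1.
   The shells and the interval [a, a + 2^-m g] meet E only in the cores of their
   subcells.  A point of E is in a solid interval or in cells of all levels; in
   the latter case it lies in the right halves of the cells preceding each
   increase of level, where E has density at least 1 - 2^-m.

   Suppose Lip f = 1_E.  Then f is 1-Lipschitz and constant on the intervals
   missing E.  Call a scale d = 2^-k g of a cell steep when
   |f (a + d) - f a| > d/2.  Starting from any cell, move to the left subcell at
   the distance given by the largest steep scale, as long as there is one.  This
   stops: otherwise the limit point c sees slopes bounded below at scales
   comparable to its distance from the centres, although c is not in E and
   Lip f c = 0.  At a cell without steep scales move to the subcell of the next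
   level.  Iterating, the limit point x is in E; between x and any nearby y there
   is either a proportionate interval missing E or a scale that is not steep, so
   |f x - f y| <= 23/24 |x - y|, contradicting Lip f x = 1. *)

Require Import Defs.
From mathcomp Require Import all_boot all_order all_algebra.
From mathcomp Require Import all_classical all_reals all_analysis borel_hierarchy.
From mathcomp Require Import ring lra.

Import Order.TTheory GRing.Theory Num.Theory.
Import numFieldNormedType.Exports.

Local Open Scope classical_set_scope.
Local Open Scope ring_scope.

(** * Powers of 1/2 and dyadic scales *)

Section dyadic.
Context {R : realType}.
Implicit Types (a g x y : R) (k m n : nat).

Definition hpow k : R := 2^-1 ^+ k.

Lemma hpow0 : hpow 0 = 1. Proof. by rewrite /hpow expr0. Qed.

Lemma hpowS k : hpow k.+1 = hpow k / 2.
Proof. by rewrite /hpow exprSr. Qed.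

Lemma hpow_gt0 k : 0 < hpow k.
Proof. by rewrite /hpow exprn_gt0 // invr_gt0. Qed.

Lemma hpow_le k j : (k <= j)%N -> hpow j <= hpow k.
Proof. by move=> kj; apply: ler_wiXn2l => //; lra. Qed.

Lemma hpow_le1 k : hpow k <= 1.
Proof. by rewrite -hpow0; exact: hpow_le. Qed.

Lemma hpow_lt k j : (hpow j < hpow k) = (k < j)%N.
Proof. by rewrite /hpow ltr_iXn2l //; lra. Qed.

Lemma hpowMle k g : 0 < g -> hpow k * g <= g.
Proof. by move=> g0; rewrite ger_pMl// hpow_le1. Qed.

Lemma hpowM_gt0 k g : 0 < g -> 0 < hpow k * g.
Proof. by move=> g0; rewrite mulr_gt0 ?hpow_gt0. Qed.

Lemma hpow_small {e : R} : 0 < e -> exists k, hpow k < e.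
Proof.
move=> e0; have e1 : 0 < e^-1 by rewrite invr_gt0.
exists (Num.truncn e^-1).+1; rewrite /hpow exprVn -[ltRHS]invrK.
rewrite ltf_pV2 ?posrE ?exprn_gt0//.
apply: (lt_le_trans (truncnS_gt _)); rewrite -natrX ler_nat.
by rewrite ltnW // ltn_expl.
Qed.

(** Take the least [j] satisfying the first inequality: minimality gives the second, and for [j = 0]
    it is the hypothesis [t <= 2 * g]. *)
Lemma dyadic_scale {g t : R} : 0 < g -> 0 < t -> t <= 2 * g ->
  exists j, hpow j * g <= t /\ t <= 2 * (hpow j * g).
Proof.
move=> g0 t0 tg.
have [k hk] := hpow_small (divr_gt0 t0 g0).
have Pk : exists k, hpow k * g <= t.
  by exists k; rewrite -ler_pdivlMr// ltW.
exists (ex_minn Pk); case: ex_minnP => -[|j] hj jmin; split => //.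
  by rewrite hpow0 mul1r.
rewrite hpowS; have : ~~ (hpow j * g <= t).
  by apply/negP => /jmin; rewrite ltnn.
by rewrite -ltNge => /ltW; lra.
Qed.

End dyadic.

Lemma nested_intervals (R : realType) (l r : nat -> R) :
  (forall i, l i <= l i.+1) -> (forall i, r i.+1 <= r i) ->
  (forall i, l i <= r i) -> exists x, forall i, l i <= x <= r i.
Proof.
move=> ln rn lr.
have lm i j : (i <= j)%N -> l i <= l j.
  elim: j => [|j IH]; first by rewrite leqn0 => /eqP->.
  by rewrite leq_eqVlt => /predU1P[->//|/IH H]; exact: le_trans (ln j).
have rm i j : (i <= j)%N -> r j <= r i.
  elim: j => [|j IH]; first by rewrite leqn0 => /eqP->.
  by rewrite leq_eqVlt => /predU1P[->//|/IH]; exact: le_trans.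
have lrij i j : l i <= r j.
  apply: (le_trans (lm _ _ (leq_maxl i j))); apply: (le_trans (lr _)).
  by apply: rm; exact: leq_maxr.
exists (sup (range l)) => i; apply/andP; split.
  apply: ub_le_sup; last by exists i.
  by exists (r 0%N) => _ [j _ <-].
by apply: ge_sup; [exists (l 0%N), 0%N | move=> _ [j _ <-]].
Qed.

(** * The nested cells and the set E *)

Section construction.
Context {R : realType}.
Implicit Types (a g x y : R) (k m n : nat).

(** With these constants the core is the middle half of its dyadic shell, and the core dilated by 2
    is exactly the shell. *)
Definition left_center k a g : R := a - 3 / 4 * (hpow k * g).
Definition left_radius k g : R := hpow k * g / 8.
(** The core dilated by 2 starts exactly at [a], and it ends well before the solid interval. *)
Definition mid_center m a g : R := a + hpow m * g / 32.
Definition mid_radius m g : R := hpow m * g / 64.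

(* [layer n m a g x]: inside the cell (m, a, g), x lies in a solid interval or
   in the right half of a cell of level at least m + n. *)
Inductive layer : nat -> nat -> R -> R -> R -> Prop :=
| layer_solid n m a g x : a + hpow m * g < x < a + g -> layer n m a g x
| layer_left n m a g x k :
    layer n m (left_center k a g) (left_radius k g) x -> layer n m a g x
| layer_right m a g x : a < x < a + g -> layer 0 m a g x
| layer_mid n m a g x :
    layer n m.+1 (mid_center m a g) (mid_radius m g) x -> layer n.+1 m a g x.

Definition Eset : set R := [set x | forall n, layer n 0 0 1 x].

Lemma left_radius_gt0 k g : 0 < g -> 0 < left_radius k g.
Proof. by move=> g0; have := hpowM_gt0 k g g0; rewrite /left_radius; lra. Qed.

Lemma mid_radius_gt0 m g : 0 < g -> 0 < mid_radius m g.
Proof. by move=> g0; have := hpowM_gt0 m g g0; rewrite /mid_radius; lra. Qed.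

Lemma left_core k a g : 0 < g ->
  [/\ a - g <= left_center k a g - left_radius k g,
   left_center k a g + left_radius k g <= a & 
   left_radius k g <= g / 8].
Proof.
move=> g0; have h0 := mulr_gt0 (hpow_gt0 k) g0.
have : hpow k * g <= g by rewrite ger_pMl// hpow_le1.
by rewrite /left_center /left_radius; split; lra.
Qed.

Lemma mid_core m a g : 0 < g ->
  [/\ a < mid_center m a g - mid_radius m g,
   mid_center m a g + mid_radius m g < a + hpow m * g & 
   mid_radius m g <= g / 8].
Proof.
move=> g0; have h0 := mulr_gt0 (hpow_gt0 m) g0.
have : hpow m * g <= g by rewrite ger_pMl// hpow_le1.
by rewrite /mid_center /mid_radius; split; lra.
Qed.

Lemma layer_core {n m a g x} : layer n m a g x -> 0 < g -> a - g < x < a + g.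
Proof.
elim=> {n m a g x} [n m a g x H|n m a g x k _ IH|m a g x|n m a g x _ IH] g0.
- by have := mulr_gt0 (hpow_gt0 m) g0; lra.
- by have := IH (left_radius_gt0 k g g0); have [] := left_core k a g g0; lra.
- lra.
- have := IH (mid_radius_gt0 m g g0); have [] := mid_core m a g g0.
  have := hpowMle m g g0; lra.
Qed.

Lemma open_layer n m a g : open (layer n m a g : set R).
Proof.
rewrite openE => x; rewrite /interior /=.
elim=> {n m a g x} [n m a g x|n m a g x k _ IH|m a g x|n m a g x _ IH].
- move=> xI; have : nbhs x [set` `]a + hpow m * g, a + g[ ].
    by apply: open_nbhs_nbhs; split; [exact: interval_open|rewrite /= in_itv].
  by apply: filterS => y; rewrite /= in_itv /=; exact: layer_solid.
- by apply: filterS IH => y; exact: layer_left.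
- move=> xI; have : nbhs x [set` `]a, a + g[ ].
    by apply: open_nbhs_nbhs; split; [exact: interval_open|rewrite /= in_itv].
  by apply: filterS => y; rewrite /= in_itv /=; exact: layer_right.
- by apply: filterS IH => y; exact: layer_mid.
Qed.

Lemma Gdelta_Eset : Gdelta Eset.
Proof.
exists (fun n => layer n 0 0 1); first by move=> n; exact: open_layer.
by apply/seteqP; split => x /= H => [n _|n]; exact: H.
Qed.

Definition inner m a g x := forall n, layer n m a g x.

(** If all [n.+1] steps [layer_mid] are used, the last one is replaced by [layer_right]: the middle
    core lies in the right half of its cell. *)
Lemma layer_pred n m a g x : 0 < g -> layer n.+1 m a g x -> layer n m a g x.
Proof.
(* The index [n.+1] becomes a variable, to allow induction on the derivation. *)
suff main n' : layer n' m a g x -> 0 < g ->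
    forall n, n' = n.+1 -> layer n m a g x.
  by move=> g0 H; apply: (main n.+1).
elim=> {n' n m a g x}
  [? m a g x ?|? m a g x k _ IH|m a g x ?|n1 m a g x H IH] g0 n En.
- exact: layer_solid.
- by apply: layer_left; apply: IH => //; exact: left_radius_gt0.
- by [].
- case: En H IH => ->; case: n => [|n] H IH; last first.
    by apply: layer_mid; apply: IH => //; exact: mid_radius_gt0.
  apply: layer_right; have := layer_core H (mid_radius_gt0 m g g0).
  by have [] := mid_core m a g g0; have := hpowMle m g g0; lra.
Qed.

Lemma inner_mid m a g x : 0 < g ->
  inner m.+1 (mid_center m a g) (mid_radius m g) x -> inner m a g x.
Proof. by move=> g0 H n; apply: layer_pred => //; exact: layer_mid. Qed.

(** A derivation ends either in a solid interval, which is a neighbourhood of [x], or in the right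
    half of a cell of level [m + n]. Each of the [n] level increases at least halves the radius,
    whence [hpow n]. *)
Lemma layer_dense {n m a g x} : layer n m a g x -> 0 < g ->
  (exists b c, b < x < c /\ (forall y, b < y < c -> inner m a g y)) \/
  (exists b d, [/\ 0 < d, d <= hpow n * g, b < x < b + d &
     forall y, b + hpow (m + n) * d < y < b + d -> inner m a g y]).
Proof.
elim=> {n m a g x} [n m a g x|n m a g x k _ IH|m a g x|n m a g x _ IH] g0.
- left; exists (a + hpow m * g), (a + g).
  by split => // y yI n'; exact: layer_solid.
- have [_ _ kg] := left_core k a g g0.
  have [[b [c [bxc H]]]|[b [d [d0 dg bx H]]]] := IH (left_radius_gt0 k g g0).
    by left; exists b, c; split => // y /H yI n'; apply: layer_left.
  right; exists b, d; split => //.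
    have := @hpow_gt0 R n; nra.
  by move=> y /H yI n'; apply: layer_left.
- move=> xI; right; exists a, g; split => //; first by rewrite hpow0; lra.
  by rewrite addn0 => y yI n'; exact: layer_solid.
- have [_ _ kg] := mid_core m a g g0.
  have [[b [c [bxc H]]]|[b [d [d0 dg bx H]]]] := IH (mid_radius_gt0 m g g0).
    by left; exists b, c; split => // y /H; exact: inner_mid.
  right; exists b, d; split => //.
    have := @hpow_gt0 R n; rewrite hpowS; nra.
  by rewrite addnS -addSn => y /H; exact: inner_mid.
Qed.

End construction.

(** * Lebesgue measure and weak density of E *)

Section measure.
Context {R : realType}.
Implicit Types (a b u v x : R) (A E : set R).

Lemma completed_lebesgue_itv (b1 b2 : bool) a b : a < b ->
  completed_lebesgue_measure ([set` Interval (BSide b1 a) (BSide b2 b)] : set R)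
  = (b - a)%:E.
Proof.
move=> ab.
set I : set R := [set` _].
have -> : completed_lebesgue_measure I = lebesgue_measure I by [].
by rewrite lebesgue_measure_itv /= lte_fin ab EFinB.
Qed.

Lemma completed_lebesgue_le A E : A `<=` E ->
  (completed_lebesgue_measure A <= completed_lebesgue_measure E)%E.
Proof. exact: (@le_outer_measure _ _ (mu_ext (@wlength R idfun))). Qed.

Lemma len_itvcc a b : a < b -> len `[a, b] = b - a.
Proof. by move=> ab; rewrite /len completed_lebesgue_itv. Qed.

Lemma len_setI_bounds E a b u v : a < b -> u < v ->
  (forall y, u < y < v -> E y /\ a <= y <= b) ->
  v - u <= len (E `&` `[a, b]) <= b - a.
Proof.
move=> ab uv H.
have lo : ((v - u)%:E <= completed_lebesgue_measure (E `&` `[a, b] : set R))%E.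
  rewrite -(completed_lebesgue_itv false true u v uv).
  apply: completed_lebesgue_le.
  by move=> y /=; rewrite !in_itv /= => /H.
have hi : (completed_lebesgue_measure (E `&` `[a, b] : set R) <= (b - a)%:E)%E.
  rewrite -(completed_lebesgue_itv true false a b ab).
  exact: completed_lebesgue_le.
(* The two bounds exclude infinite measure, on which [fine] would return 0. *)
rewrite /len; move: lo hi.
by case: completed_lebesgue_measure => [r| |] //=; rewrite !lee_fin => -> ->.
Qed.

Lemma Gdelta_Lebesgue_measurable E : Gdelta E -> Lebesgue_measurable E.
Proof. by move=> /Gdelta_measurable; exact: sub_caratheodory. Qed.

Lemma cvg_hpow : (@hpow R) @ \oo --> (0 : R).
Proof. by apply: cvg_expr; rewrite ger0_norm ?invr_ge0//; lra. Qed.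

Lemma weakly_dense_atP E x :
  (forall n, exists a b u v, [/\ a < b, a <= x <= b, b - a <= hpow n, u < v &
     (forall y, u < y < v -> E y /\ a <= y <= b) /\
     (1 - hpow n) * (b - a) <= v - u]) ->
  weakly_dense_at E x.
Proof.
move=> /choice[a /choice[b /choice[u /choice[v H]]]]; exists a, b => /=.
have ab n : a n < b n by case: (H n).
have lenI n : len `[a n, b n] = b n - a n by rewrite len_itvcc.
split => //.
- by move=> n; case: (H n) => _ xI _ _ _; rewrite /= in_itv.
- under eq_fun do rewrite lenI.
  apply: (@squeeze_cvgr _ _ _ _ (fun=> 0) (@hpow R)); last 2 first.
  + exact: cvg_cst.
  + exact: cvg_hpow.
  by apply: nearW => n; case: (H n) => ? _ ? _ _; apply/andP; split; lra.
under eq_fun do rewrite lenI.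
apply: (@squeeze_cvgr _ _ _ _ (fun n => 1 - hpow n) (fun=> 1)); last 2 first.
- rewrite -[X in _ --> X]subr0; apply: cvgB; [exact: cvg_cst|exact: cvg_hpow].
- exact: cvg_cst.
apply: nearW => n; case: (H n) => abn _ _ uv [HE le].
have /andP[lo hi] := len_setI_bounds E _ _ _ _ abn uv HE.
have ba0 : 0 < b n - a n by lra.
rewrite ler_pdivlMr // ler_pdivrMr // mul1r hi andbT; lra.
Qed.

Lemma weakly_dense_Eset : weakly_dense (@Eset R).
Proof.
split; first exact/Gdelta_Lebesgue_measurable/Gdelta_Eset.
move=> x Ex; apply: weakly_dense_atP => n; have h0 := @hpow_gt0 R n.
(* Layer [n.+1] rather than [n] keeps the solid subinterval non-degenerate also for [n = 0]. *)
have [[b [c [bxc H]]]|[b [d [d0 dg bx H]]]] := layer_dense (Ex n.+1) ltr01.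
  pose e := Num.min ((x + c) / 2) (x + hpow n).
  have [ec eh xe] : [/\ e < c, e <= x + hpow n & x < e].
    by rewrite /e; split; rewrite ?lt_min ?ge_min ?gt_min ?lexx ?orbT//; lra.
  exists x, e, x, e; split; [lra|lra|lra|lra|split].
    by move=> y yI; split; [apply: H|]; lra.
  by nra.
have hd := mulr_gt0 h0 d0; have h1 := @hpow_le1 R n.
move: dg H; rewrite add0n hpowS => dg H.
have hdd : hpow n * d <= d by exact: hpowMle.
exists b, (b + d), (b + hpow n / 2 * d), (b + d).
split; [lra|lra|lra|lra|split].
  by move=> y yI; split; [apply: H|]; lra.
by lra.
Qed.

End measure.

(** * Pointwise slopes and a mean value inequality *)

Section local_lipschitz.
Context {R : realType}.
Implicit Types (f : R -> R) (x y c : R).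

Definition slope_le f x c :=
  exists2 d, 0 < d & forall y, `|x - y| < d -> `|f x - f y| <= c * `|x - y|.

Lemma Lip_lt f x c : (Lip f x < c%:E)%E -> slope_le f x c.
Proof.
rewrite /Lip limf_esupE => /ereal_inf_lt[_ [V + <-]] Vc.
rewrite /at_right => -[d /= d0 HV]; exists d => // y yd.
have [->|xy] := eqVneq x y; first by rewrite !subrr normr0 mulr0.
have r0 : 0 < `|x - y| by rewrite normr_gt0 subr_eq0.
have Vr : V `|x - y|.
  by apply: HV => //=; rewrite sub0r normrN normr_id.
have : (max_slope f x `|x - y|%R <= c%:E)%E.
  by apply/ltW/(le_lt_trans _ Vc)/ereal_sup_ubound; exists `|x - y|.
apply: contraTT; rewrite -!ltNge => h; rewrite /max_slope.
apply: (@lt_le_trans _ _ ((`|x - y|^-1)%R%:E * `|f x - f y|%R%:E)%E).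
  by rewrite -EFinM lte_fin mulrC ltr_pdivlMr.
apply: lee_wpmul2l; first by rewrite lee_fin invr_ge0.
by apply: ereal_sup_ubound; exists y => /=.
Qed.

Lemma slope_le_Lip f x c : 0 <= c -> slope_le f x c -> (Lip f x <= c%:E)%E.
Proof.
move=> c0 [d d0 H]; rewrite /Lip limf_esupE.
pose V := [set r | 0 < r < d].
apply: (@le_trans _ _ (ereal_sup (max_slope f x @` V))).
  apply: ereal_inf_lbound; exists V => //.
  exists d => // r /=; rewrite sub0r normrN => rd r0.
  by rewrite /V /= r0; move: rd; rewrite gtr0_norm.
apply: ge_ereal_sup => _ [r /andP[r0 rd] <-]; rewrite /max_slope.
rewrite lee_pdivrMl// -EFinM; apply: ge_ereal_sup => _ [y /= yr <-].
rewrite lee_fin mulrC; apply: (le_trans (H _ (le_lt_trans yr rd))).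
exact: ler_wpM2l.
Qed.

(** Supremum argument: the points up to which the bound from [u] holds contain their supremum, and
    the slope bound there would push the set further if the supremum were below [v]. *)
Lemma slope_le_segment f u v c : u <= v ->
  (forall x e, u <= x <= v -> 0 < e -> slope_le f x (c + e)) ->
  `|f u - f v| <= c * (v - u).
Proof.
move=> uv H; apply/ler_addgt0Pr => e e0.
(* Then [e' * (v - u) <= e]; the added 1 covers [u = v]. *)
pose e' := e / (v - u + 1).
have e'0 : 0 < e' by apply: divr_gt0 => //; lra.
pose S := [set t | u <= t <= v /\ `|f u - f t| <= (c + e') * (t - u)].
have Su : S u by split; [lra|rewrite !subrr normr0 mulr0].
have supS : has_sup S by split; [exists u|exists v => t [] /andP[]].
have uS : u <= sup S by exact: (ub_le_sup supS.2).
have Sv : sup S <= v by apply: ge_sup; [exists u|move=> t [] /andP[]].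
have [d d0 Hd] := H _ _ (introT andP (conj uS Sv)) e'0.
have SS : S (sup S).
  split; first lra.
  have [t St tS] := sup_adherent d0 supS.
  have tle : t <= sup S by exact: (ub_le_sup supS.2).
  have := Hd t; rewrite ger0_norm ?subr_ge0// => /(_ _)/wrap[|h]; first lra.
  have := ler_distD (f t) (f u) (f (sup S)).
  by move: (St.2) h; rewrite (distrC (f t)); lra.
suff : S v.
  move=> [_ le]; apply: (le_trans le); rewrite mulrDl lerD2l /e' mulrAC.
  by rewrite ler_pdivrMr ?ler_pM2l; lra.
have [<-//|sv] := eqVneq (sup S) v.
have {}sv : sup S < v by lra.
pose t := Num.min v (sup S + d / 2).
have [tv td st] : [/\ t <= v, t <= sup S + d / 2 & sup S < t].
  by rewrite /t; split; rewrite ?ge_min ?lt_min ?lexx ?orbT//; lra.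
suff St : S t by have := ub_le_sup supS.2 St; lra.
split; first lra.
have := Hd t; rewrite ltr0_norm ?subr_lt0// => /(_ _)/wrap[|h]; first lra.
by have := ler_distD (f (sup S)) (f u) (f t); move: (SS.2) h; lra.
Qed.

End local_lipschitz.

(** * Hulls of cells and the position of E in them *)

Section geometry.
Context {R : realType}.
Implicit Types (a g x y : R) (k m n : nat).

Lemma hpow_half {k j g} : (k < j)%N -> 0 < g -> hpow j * g <= hpow k * g / 2.
Proof.
by move=> kj g0; rewrite mulrAC -hpowS ler_pM2r//; exact: hpow_le.
Qed.

Definition left_shell k a g x := a - hpow k * g <= x <= a - hpow k * g / 2.
Definition in_core a g x := a - g < x < a + g.
Definition in_hull a g x := a - 2 * g <= x <= a + 2 * g.

Lemma left_hullE k a g x :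
  in_hull (left_center k a g) (left_radius k g) x = left_shell k a g x.
Proof.
rewrite /in_hull /left_shell /left_center /left_radius.
by apply/idP/idP => ?; lra.
Qed.

Lemma left_coreE k a g x : in_core (left_center k a g) (left_radius k g) x =
  (a - 7 / 8 * (hpow k * g) < x < a - 5 / 8 * (hpow k * g)).
Proof.
rewrite /in_core /left_center /left_radius.
by apply/idP/idP => ?; lra.
Qed.

Lemma mid_hullE m a g x : in_hull (mid_center m a g) (mid_radius m g) x =
  (a <= x <= a + hpow m * g / 16).
Proof.
rewrite /in_hull /mid_center /mid_radius.
by apply/idP/idP => ?; lra.
Qed.

Lemma mid_coreE m a g x : in_core (mid_center m a g) (mid_radius m g) x =
  (a + hpow m * g / 64 < x < a + 3 / 64 * (hpow m * g)).
Proof.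
rewrite /in_core /mid_center /mid_radius.
by apply/idP/idP => ?; lra.
Qed.

(** Shells share at most endpoints, and each core lies strictly inside its shell. *)
Lemma left_shell_uniq {j k a g x} : 0 < g -> left_shell k a g x ->
  in_core (left_center j a g) (left_radius j g) x -> j = k.
Proof.
rewrite left_coreE /left_shell => g0 xk xj.
have dj := hpowM_gt0 j g g0; have dk := hpowM_gt0 k g g0.
by case: (ltngtP j k) => // jk; exfalso; have := hpow_half jk g0; lra.
Qed.

(** The positive index rules out [layer_right]. *)
Lemma layer_inv {n m a g x} : 0 < g -> layer n.+1 m a g x ->
  [\/ a + hpow m * g < x < a + g,
   exists2 k, in_core (left_center k a g) (left_radius k g) x &
     layer n.+1 m (left_center k a g) (left_radius k g) x |
   in_core (mid_center m a g) (mid_radius m g) x /\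
     layer n m.+1 (mid_center m a g) (mid_radius m g) x].
Proof.
move=> g0 H.
inversion H as [? ? ? ? ? xI|? ? ? ? ? k Hk|? ? ? ? xI|? ? ? ? ? Hm]; subst.
- exact: Or31.
- apply: Or32; exists k => //; exact: (layer_core Hk (left_radius_gt0 k g g0)).
- apply: Or33; split => //; exact: (layer_core Hm (mid_radius_gt0 m g g0)).
Qed.

(* The cells obtained from (0, 0, 1) satisfy this, as their hulls (the cores
   dilated by 2) are essentially disjoint from the other cells. *)
Definition node m a g :=
  0 < g /\ forall x, in_hull a g x -> Eset x -> inner m a g x.

Lemma node_root : node 0 0 1.
Proof. by split=> // x _. Qed.

Lemma node_left {k m a g} :
  node m a g -> node m (left_center k a g) (left_radius k g).
Proof.
move=> [g0 H]; split=> [|x]; first exact: left_radius_gt0.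
rewrite left_hullE => xk Ex.
have dk := hpowM_gt0 k g g0; have dg := hpowMle k g g0.
have dm := hpowM_gt0 m g g0.
have xh : in_hull a g x by move: xk; rewrite /left_shell /in_hull; lra.
(* A left move keeps the index, and [layer_inv] requires a positive one, so layer [n.+1] is found
   and then lowered. *)
move=> n; apply: layer_pred; first exact: left_radius_gt0.
have := layer_inv g0 (H x xh Ex n.+1).
move=> [xI|[j /(left_shell_uniq g0 xk) ->//]|[]].
  by move: xk; rewrite /left_shell; lra.
by rewrite mid_coreE; move: xk; rewrite /left_shell; lra.
Qed.

Lemma node_mid {m a g} :
  node m a g -> node m.+1 (mid_center m a g) (mid_radius m g).
Proof.
move=> [g0 H]; split=> [|x]; first exact: mid_radius_gt0.
rewrite mid_hullE => xk Ex.
have dg := hpowMle m g g0; have dm := hpowM_gt0 m g g0.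
have xh : in_hull a g x by move: xk; rewrite /in_hull; lra.
move=> n; have [xI|[j]|[]//] := layer_inv g0 (H x xh Ex n.+1).
  by lra.
by rewrite left_coreE; have := hpowM_gt0 j g g0; lra.
Qed.

Lemma node_E {m a g x} : node m a g -> in_hull a g x -> Eset x ->
  [\/ a + hpow m * g < x < a + g,
   exists k, in_core (left_center k a g) (left_radius k g) x |
   in_core (mid_center m a g) (mid_radius m g) x].
Proof.
move=> [g0 H] xh Ex; have [|[k]|[]] := layer_inv g0 (H x xh Ex 1).
- exact: Or31.
- by move=> xk _; apply: Or32; exists k.
- by move=> xm _; exact: Or33.
Qed.

Lemma left_gap {k m a g x} : node m a g -> left_shell k a g x ->
  ~ in_core (left_center k a g) (left_radius k g) x -> ~ Eset x.
Proof.
move=> nd xk xc; have g0 := nd.1 => Ex.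
have dk := hpowM_gt0 k g g0; have dg := hpowMle k g g0.
have dm := hpowM_gt0 m g g0.
have xh : in_hull a g x by move: xk; rewrite /left_shell /in_hull; lra.
have [xI|[j xj]|] := node_E nd xh Ex.
- by move: xk; rewrite /left_shell; lra.
- by apply: xc; rewrite -(left_shell_uniq g0 xk xj).
- by rewrite mid_coreE; move: xk; rewrite /left_shell; lra.
Qed.

Lemma mid_gap {m a g x} : node m a g -> a <= x <= a + hpow m * g ->
  ~ in_core (mid_center m a g) (mid_radius m g) x -> ~ Eset x.
Proof.
move=> nd xk xc; have g0 := nd.1 => Ex.
have dg := hpowMle m g g0.
have xh : in_hull a g x by rewrite /in_hull; lra.
have [xI|[j]|//] := node_E nd xh Ex; first lra.
by rewrite left_coreE; have := hpowM_gt0 j g g0; lra.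
Qed.

(** Derivations are finite: with positive index they leave the left moves for a solid interval or a
    middle core, to the right of the current centre, while the next core of [s] is to its left. The
    induction shifts the sequence [s] at each left move. *)
Lemma infinite_left_notin {n m x} (c r : R) : layer n m c r x -> (0 < n)%N ->
  0 < r -> forall (s : nat -> R * R) (k : nat -> nat), s 0%N = (c, r) ->
  (forall i, s i.+1 = (left_center (k i) (s i).1 (s i).2,
                        left_radius (k i) (s i).2)) ->
  ~ forall i, in_core (s i).1 (s i).2 x.
Proof.
elim=> {n m c r x}
  [n m a g x xI|n m a g x j H IH|//|n m a g x H _] n0 g0 s k s0 sS xs.
- have := xs 1%N; rewrite sS s0 left_coreE /=.
  by have := hpowM_gt0 (k 0%N) g g0; have := hpowM_gt0 m g g0; lra.
- have xj := layer_core H (left_radius_gt0 j g g0).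
  have xk : left_shell (k 0%N) a g x.
    have := xs 1%N; rewrite sS s0 left_coreE /left_shell /=.
    by have := hpowM_gt0 (k 0%N) g g0; lra.
  have jk := left_shell_uniq g0 xk xj.
  apply: (IH n0 (left_radius_gt0 j g g0) (fun i => s i.+1) (fun i => k i.+1)).
  + by rewrite sS s0 jk.
  + by move=> i; rewrite sS.
  + by move=> i; exact: xs.
- have := xs 1%N; rewrite sS s0 left_coreE /=.
  have := layer_core H (mid_radius_gt0 m g g0).
  rewrite -/(in_core _ _ _) mid_coreE.
  by have := hpowM_gt0 (k 0%N) g g0; have := hpowM_gt0 m g g0; lra.
Qed.

(** * Slope estimates for 1-Lipschitz functions that are constant off E *)

Section flat_off_E.
Variable f : R -> R.
Hypothesis f_lip : forall u v, u <= v -> `|f v - f u| <= v - u.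
Hypothesis f_flat :
  forall u v, u <= v -> (forall x, u <= x <= v -> ~ Eset x) -> f u = f v.

Lemma flat_gap_bound {y u v x} : y <= u -> u <= v -> v <= x -> f u = f v ->
  `|f x - f y| <= (x - y) - (v - u).
Proof.
move=> yu uv vx fuv; have h1 := f_lip _ _ yu; have h2 := f_lip _ _ vx.
by have := ler_distD (f u) (f x) (f y); rewrite {1}fuv; lra.
Qed.

Lemma left_pad_left {k m a g} : node m a g ->
  f (a - hpow k * g) = f (a - 7 / 8 * (hpow k * g)).
Proof.
move=> nd; have dk := hpowM_gt0 k g nd.1.
apply: f_flat; first lra.
move=> x xI; apply: (left_gap (k := k) nd).
  by rewrite /left_shell; lra.
by rewrite left_coreE; lra.
Qed.

Lemma left_pad_right {k m a g} : node m a g ->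
  f (a - 5 / 8 * (hpow k * g)) = f (a - hpow k * g / 2).
Proof.
move=> nd; have dk := hpowM_gt0 k g nd.1.
apply: f_flat; first lra.
move=> x xI; apply: (left_gap (k := k) nd).
  by rewrite /left_shell; lra.
by rewrite left_coreE; lra.
Qed.

Definition steep k a g :=
  hpow k * g / 2 < `|f (a + hpow k * g) - f a|.

(** With [d] the dyadic scale in [[s/2, s]], the increment is at most [d/2] up to [a + d] and at
    most [s - d] beyond; the sum [s - d/2] is at most [3/4 s]. *)
Lemma not_steep_right {a g s} : 0 < g -> 0 < s -> s <= 2 * g ->
  (forall j, s <= 2 * (hpow j * g) -> ~ steep j a g) ->
  `|f (a + s) - f a| <= 3 / 4 * s.
Proof.
move=> g0 s0 sg H; have [j [js sj]] := dyadic_scale g0 s0 sg.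
have /negP := H j sj; rewrite /steep -leNgt => h.
have jj : a + hpow j * g <= a + s by lra.
have := f_lip _ _ jj.
by have := ler_distD (f (a + hpow j * g)) (f (a + s)) (f a); lra.
Qed.

(** For [y] left of the shell or close on the right, a flat pad of the shell at a comparable
    distance separates [x] from [y]; for [y] far on the right, the scale near [y - a] is larger than
    scale [k], hence not steep. *)
Lemma left_step {k m a g x y} : node m a g ->
  (forall j, (j < k)%N -> ~ steep j a g) ->
  in_core (left_center k a g) (left_radius k g) x ->
  in_hull a g y -> ~ in_hull (left_center k a g) (left_radius k g) y ->
  `|f x - f y| <= 23 / 24 * `|x - y|.
Proof.
move=> nd nst; rewrite left_coreE left_hullE /left_shell /in_hull => xk yh yk.
have g0 := nd.1; have dk := hpowM_gt0 k g g0.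
have [ylt|ygt] : y < a - hpow k * g \/ a - hpow k * g / 2 < y.
- case: (ltP y (a - hpow k * g)) => h; [by left|right].
  by rewrite ltNge; apply/negP => h'; apply: yk; lra.
- have t0 : 0 < a - y by lra.
  have tg : a - y <= 2 * g by lra.
  have [j [jt tj]] := dyadic_scale g0 t0 tg.
  have jk : (j <= k)%N.
    by rewrite leqNgt; apply/negP => /hpow_half/(_ g0); lra.
  have djk : hpow k * g <= hpow j * g by rewrite ler_pM2r// hpow_le.
  rewrite [`|x - y|]ger0_norm; last lra.
  have := @flat_gap_bound y _ _ x _ _ _ (left_pad_left (k := j) nd); lra.
- rewrite distrC (distrC x) [`|y - x|]ger0_norm; last lra.
  case: (leP (y - a) (2 * (hpow k * g))) => sk.
    (* The tightest case for 23/24: with [d] the scale, a flat piece of length [d/8] within a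
       distance below [(2 + 7/8) d] gives slope at most 22/23. *)
    have := @flat_gap_bound x _ _ y _ _ _ (left_pad_right (k := k) nd); lra.
  have s0 : 0 < y - a by lra.
  have sg : y - a <= 2 * g by lra.
  have := @not_steep_right a g _ g0 s0 sg.
  rewrite subrKC => /(_ _)/wrap[j sj|h].
    apply: nst; rewrite -(@hpow_lt R) -(ltr_pM2r g0); lra.
  have xa : x <= a by lra.
  have := f_lip _ _ xa; have := ler_distD (f a) (f y) (f x); lra.
Qed.

Lemma mid_step {m a g x y} : node m a g -> (forall j, ~ steep j a g) ->
  in_core (mid_center m a g) (mid_radius m g) x ->
  in_hull a g y -> ~ in_hull (mid_center m a g) (mid_radius m g) y ->
  `|f x - f y| <= 23 / 24 * `|x - y|.
Proof.
move=> nd nst; rewrite mid_coreE mid_hullE /in_hull => xk yh yk.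
have g0 := nd.1; have dm := hpowM_gt0 m g g0; have dg := hpowMle m g g0.
have padl : f a = f (a + hpow m * g / 64).
  apply: f_flat => [|z zI]; first lra.
  by apply: (mid_gap nd); rewrite ?mid_coreE; lra.
have ax : a <= x by lra.
(* The flat piece has length [2^-m g / 64], and [x - a] is less than three times that. *)
have hax : `|f x - f a| <= 2 / 3 * (x - a).
  have := @flat_gap_bound a _ _ x _ _ _ padl; lra.
have [ylt|ygt] : y < a \/ a + hpow m * g / 16 < y.
- case: (ltP y a) => h; [by left|right].
  by rewrite ltNge; apply/negP => h'; apply: yk; lra.
- have t0 : 0 < a - y by lra.
  have tg : a - y <= 2 * g by lra.
  have [j [jt tj]] := dyadic_scale g0 t0 tg.
  have dj := hpowM_gt0 j g g0.
  rewrite [`|x - y|]ger0_norm; last lra.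
  have := @flat_gap_bound y _ _ a _ _ _ (left_pad_left (k := j) nd).
  have := ler_distD (f a) (f x) (f y); lra.
- rewrite distrC (distrC x) [`|y - x|]ger0_norm; last lra.
  case: (leP y (a + hpow m * g)) => sk.
    have padr : f (a + 3 / 64 * (hpow m * g)) = f y.
      apply: f_flat => [|z zI]; first lra.
      by apply: (mid_gap nd); rewrite ?mid_coreE; lra.
    have := @flat_gap_bound x _ _ y _ _ _ padr; lra.
  have s0 : 0 < y - a by lra.
  have sg : y - a <= 2 * g by lra.
  have := @not_steep_right a g _ g0 s0 sg.
  rewrite subrKC => /(_ _)/wrap[j _|h].
    exact: nst.
  have := ler_distD (f a) (f y) (f x); rewrite (distrC (f a)); lra.
Qed.

End flat_off_E.
End geometry.

(** * Descent through the cells to a point of E with small slope *)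

Section descent.
Context {R : realType}.
Variable f : R -> R.
Hypothesis f_lip : forall u v, u <= v -> `|f v - f u| <= v - u.
Hypothesis f_flat :
  forall u v, u <= v -> (forall x, u <= x <= v -> ~ Eset x) -> f u = f v.
Hypothesis f_slope0 : forall x e, ~ Eset x -> 0 < e -> slope_le f x e.

Definition strict_subcore a g a' g' : Prop :=
  [/\ 0 < g', a - g < a' - g', a' + g' < a + g & g' <= g / 2 :> R].

Lemma left_subcore k a g : 0 < g ->
  strict_subcore a g (left_center k a g) (left_radius k g).
Proof.
move=> g0; have := hpowM_gt0 k g g0; have := hpowMle k g g0.
by rewrite /strict_subcore /left_center /left_radius; split; lra.
Qed.

Lemma mid_subcore m a g : 0 < g ->
  strict_subcore a g (mid_center m a g) (mid_radius m g).
Proof.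
move=> g0; have := hpowM_gt0 m g g0; have := hpowMle m g g0.
by rewrite /strict_subcore /mid_center /mid_radius; split; lra.
Qed.

(** Strict inclusion puts the limit point, found in the closed intervals, inside every open core. *)
Lemma nested_cores (s : nat -> R * R) : 0 < (s 0%N).2 ->
  (forall i, strict_subcore (s i).1 (s i).2 (s i.+1).1 (s i.+1).2) ->
  (forall i, (s i).2 <= hpow i * (s 0%N).2) /\
  exists x, forall i, in_core (s i).1 (s i).2 x.
Proof.
move=> s0 sS; have sp i : 0 < (s i).2 by case: i => // i; case: (sS i).
split; first elim=> [|i IH]; first by rewrite hpow0 mul1r.
  by rewrite hpowS; case: (sS i); lra.
have [i|i|i|x xs] := @nested_intervals R (fun i => (s i).1 - (s i).2)
  (fun i => (s i).1 + (s i).2).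
- by case: (sS i); lra.
- by case: (sS i); lra.
- by have := sp i; lra.
by exists x => i; have := xs i.+1; rewrite /in_core; case: (sS i); lra.
Qed.

(** Records one gain of level after any number of left moves; the last clause compares points
    leaving the inner hull but still in the outer one. *)
Definition descends m a g a' g' : Prop :=
  [/\ node m.+1 a' g', strict_subcore a g a' g',
      forall x, in_core a' g' x -> layer 0 m a g x,
      forall n x, layer n m.+1 a' g' x -> layer n.+1 m a g x &
      forall x y, in_core a' g' x -> in_hull a g y -> ~ in_hull a' g' y ->
        `|f x - f y| <= 23 / 24 * `|x - y| ].

Lemma descends_mid m a g : node m a g -> (forall j, ~ steep f j a g) ->
  descends m a g (mid_center m a g) (mid_radius m g).
Proof.
move=> nd nst; split.
- exact: node_mid.
- exact: mid_subcore nd.1.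
- move=> x xc; apply: layer_right; move: xc; rewrite mid_coreE.
  by have := hpowM_gt0 m g nd.1; have := hpowMle m g nd.1; lra.
- by move=> n x; exact: layer_mid.
- by move=> x y; exact: mid_step.
Qed.

Lemma descends_left k m a g a' g' : node m a g ->
  (forall j, (j < k)%N -> ~ steep f j a g) ->
  descends m (left_center k a g) (left_radius k g) a' g' ->
  descends m a g a' g'.
Proof.
move=> nd nst [nd' sub l0 ln bound]; have sub' := left_subcore k a g nd.1.
split => //.
- move: sub sub'; rewrite /strict_subcore => -[? ? ? ?] [? ? ? ?].
  by split; lra.
- by move=> x /l0; exact: layer_left.
- by move=> n x /ln; exact: layer_left.
move=> x y xc yh yh'.
case: (boolP (in_hull (left_center k a g) (left_radius k g) y)) => yk.
  exact: bound.
apply: (left_step f f_lip f_flat nd nst _ yh (negP yk)).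
by move: sub xc; rewrite /in_core => -[]; lra.
Qed.

Lemma descent m a g : node m a g -> exists a' g', descends m a g a' g'.
Proof.
move=> nd; apply: contrapT => nodesc.
pose bad (p : R * R) :=
  node m p.1 p.2 /\ ~ exists a' g', descends m p.1 p.2 a' g'.
have step (p : R * R) : exists k, bad p -> steep f k p.1 p.2 /\
    bad (left_center k p.1 p.2, left_radius k p.2).
  have [st|nst] := pselect (exists k, `[< steep f k p.1 p.2 >]); last first.
    (* The value 0 is a dummy: without steep scales the middle subcell is a descent, so the cell is
       not bad. *)
    exists 0%N => -[ndp []]; eexists; eexists; apply: descends_mid => // j sj.
    by apply: nst; exists j; exact/asboolP.
  exists (ex_minn st); case: ex_minnP => k /asboolP sk kmin [ndp nop].
  split => //; split; first exact: node_left.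
  move=> [a' [g' H]]; apply: nop; exists a', g'; apply: descends_left H => //.
  by move=> j jk /asboolP/kmin; rewrite leqNgt jk.
have [K HK] := choice step.
pose next (p : R * R) := (left_center (K p) p.1 p.2, left_radius (K p) p.2).
pose s i := iter i next (a, g).
have sb i : bad (s i) by elim: i => [//|i IH]; exact: (HK _ IH).2.
have s0 : 0 < (s 0%N).2 by exact: nd.1.
have [sg [c cs]] : (forall i, (s i).2 <= hpow i * (s 0%N).2) /\
    exists x, forall i, in_core (s i).1 (s i).2 x.
  by apply: nested_cores => // i; apply: left_subcore; exact: (sb i).1.1.
have cE : ~ Eset c.
  move=> Ec; have ch : in_hull a g c.
    by have := cs 0%N; rewrite /in_core /in_hull /= in s0 *; lra.
  exact: (infinite_left_notin _ _ (nd.2 c ch Ec 1) _ nd.1 s (fun i => K (s i))).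
(* The limit [c] is within [7/8 D] of [A] and [15/8 D] of [A + D], so slope 1/8 allows an increment
   of [11/32 D], below the steep [D/2]. *)
have e0 : (0 : R) < 1 / 8 by lra.
have [d d0 Hd] := f_slope0 _ _ cE e0.
have [i di] := hpow_small (divr_gt0 d0 (mulr_gt0 (ltr0Sn R 1) s0)).
have gi := (sb i).1.1.
have gid : 2 * (s i).2 < d.
  have s0' : 0 < 2 * (s 0%N).2 by rewrite mulr_gt0.
  by move: di; rewrite ltr_pdivlMr//; have := sg i; lra.
have := cs i.+1; rewrite /s iterS -/(s i) left_coreE.
have := (HK _ (sb i)).1; rewrite /steep.
have := hpowMle (K (s i)) _ gi; have := hpowM_gt0 (K (s i)) _ gi.
set D := hpow _ * _; set A := (s i).1 => D0 Dg st cI.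
have := Hd A; rewrite ltr0_norm; last lra.
move=> /(_ _)/wrap[|h1]; first lra.
have := Hd (A + D); rewrite ltr0_norm; last lra.
move=> /(_ _)/wrap[|h2]; first lra.
have := ler_distD (f c) (f (A + D)) (f A); rewrite (distrC _ (f c)).
by lra.
Qed.

Lemma exists_flat_point : exists2 x, Eset x & slope_le f x (23 / 24).
Proof.
have step (p : nat * (R * R)) : exists q : R * R, node p.1 p.2.1 p.2.2 ->
    descends p.1 p.2.1 p.2.2 q.1 q.2.
  have [/descent[a' [g' H]]|nnd] := pselect (node p.1 p.2.1 p.2.2).
    by exists (a', g').
  (* Dummy value; the sequence [s] only visits nodes. *)
  by exists (0, 0).
have [Q HQ] := choice step.
pose s := fix s i := if i is j.+1 then Q (j, s j) else (0, 1).
have sn i : node i (s i).1 (s i).2.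
  elim: i => [|i IH] /=; first exact: node_root.
  by case: (HQ (i, s i) IH).
have sd i : descends i (s i).1 (s i).2 (s i.+1).1 (s i.+1).2.
  exact: (HQ (i, s i)).
have [sg [x xs]] : (forall i, (s i).2 <= hpow i * (s 0%N).2) /\
    exists x, forall i, in_core (s i).1 (s i).2 x.
  by apply: nested_cores => [|i]; [exact: ltr01|case: (sd i)].
(* All levels [i] are treated at once, since layer [n.+1] at level [i] comes from layer [n] at level
   [i.+1]. *)
have xl n : forall i, layer n i (s i).1 (s i).2 x.
  elim: n => [|n IH] i; case: (sd i) => _ _ l0 ln _; first exact/l0/xs.
  exact/ln/IH.
exists x; first by move=> n; exact: (xl n 0%N).
exists 1 => // y xy; have [->|nxy] := eqVneq x y.
  by rewrite !subrr normr0 mulr0.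
have r0 : 0 < `|x - y| by rewrite normr_gt0 subr_eq0.
(* A core point and a hull point of one cell are within 3 radii, and the radii tend to 0. *)
have out : exists i, ~~ in_hull (s i).1 (s i).2 y.
  have [i hi] := hpow_small (divr_gt0 r0 (ltr0Sn R 2)).
  exists i; apply/negP => yi; move: (xs i) (sg i) hi yi.
  rewrite /in_core /in_hull /= mulr1 ltr_pdivlMr//.
  by case: (ger0P (x - y)); lra.
(* The first hull missing [y] is not the initial one, as [|x - y| < 1]; hence [y] is in hull [j] but
   not in hull [j.+1], where the bound of [descends] applies. *)
case: (ex_minnP out) => -[|j] /negP yj jmin.
  exfalso; apply: yj; have := xs 0%N; rewrite /in_core /in_hull /=.
  by move: xy; case: (ger0P (x - y)); lra.
case: (sd j) => _ _ _ _; apply => //.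
by apply/negPn/negP => /jmin; rewrite ltnn.
Qed.

End descent.

Theorem theorem6p3 (R : realType) :
  exists E : set R, [/\ Gdelta E, weakly_dense E & ~ Lip1 E].
Proof.
exists Eset; split; [exact: Gdelta_Eset|exact: weakly_dense_Eset|].
move=> [f [_ fE]].
have slope1 x e : 0 < e -> slope_le f x (1 + e).
  move=> e0; apply: Lip_lt; rewrite fE lte_fin indicE.
  by case: (x \in Eset) => /=; lra.
have slope0 x e : ~ Eset x -> 0 < e -> slope_le f x e.
  by move=> xE e0; apply: Lip_lt; rewrite fE lte_fin indicE memNset.
have [u v uv|u v uv uvE|//|x Ex sx] := exists_flat_point f.
- rewrite distrC -[leRHS]mul1r.
  by apply: slope_le_segment => // x e _; exact: slope1.
- apply/eqP; rewrite -subr_eq0 -normr_le0 -[leRHS](mul0r (v - u)).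
  apply: slope_le_segment => // x e xI e0; rewrite add0r; apply: slope0 => //.
  exact: uvE.
have c0 : (0 : R) <= 23 / 24 by lra.
have := slope_le_Lip _ _ _ c0 sx.
by rewrite fE indicE mem_set//= lee_fin; lra.
Qed.
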